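(* Let $p,q,Q,m,N_1,\dots,N_m,J,L$ be as in the context (in particular $\emptyset\ne L\subseteq J\subseteq\{1,\dots,m\}$, $N_j-1$ divides $Q-1$ for all $j$, and $q-1$ divides $N_j-1$ for all $j\in L$). Let $\Delta=\bigcup_{l=1}^r\mathfrak{I}_{\boldsymbol{a}_l}$, where $\{\boldsymbol{a}_1,\boldsymbol{a}_2,\dots,\boldsymbol{a}_r\}$ is a subset of $\mathcal{A}$ with cardinality $r\le q-2$. If the integers $\sigma_L(\boldsymbol{a}_1),\sigma_L(\boldsymbol{a}_2),\dots,\sigma_L(\boldsymbol{a}_r)$ are pairwise different modulo $q-1$, then the subfield-subcode $\mathcal{C}^J_\Delta$ is an LRC code with locality $\le r$.
   Context: **Fields and varieties.** Let $p$ be a prime, $q=p^s$, $Q=p^\ell$ with $s\mid \ell$, so $\mathbb{F}_q\subseteq\mathbb{F}_Q$. Let $m\ge1$, $\mathfrak{R}=\mathbb{F}_Q[X_1,\dots,X_m]$, and write $X^{\boldsymbol{a}}=X_1^{a_1}\cdots X_m^{a_m}$. Fix integers $N_j>1$ ($1\le j\le m$) with $N_j-1$ dividing $Q-1$. Let $J\subseteq\{1,\dots,m\}$ and let $I_J\subset\mathfrak{R}$ be the ideal generated by $X_j^{N_j-1}-1$ for $j\in J$ and $X_j^{N_j}-X_j$ for $j\notin J$; $\mathfrak{R}_J=\mathfrak{R}/I_J$. Put $T_j=N_j-2$ if $j\in J$ and $T_j=N_j-1$ otherwise, and $\mathcal{H}_J=\prod_{j=1}^m\{0,1,\dots,T_j\}$.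 Let $Z_J=\{P_1,\dots,P_{n_J}\}\subset\mathbb{F}_Q^m$ be the zero set of $I_J$, of size $n_J=\prod_{j\notin J}N_j\prod_{j\in J}(N_j-1)$, and $\mathrm{ev}_J:\mathfrak{R}_J\to\mathbb{F}_Q^{n_J}$, $\mathrm{ev}_J(f)=(f(P_1),\dots,f(P_{n_J}))$. **Standing assumption.** $L$ is a fixed non-empty subset of $J$ such that $q-1$ divides $N_j-1$ for all $j\in L$. **Codes.** For non-empty $\Delta\subseteq\mathcal{H}_J$, $E^J_\Delta$ is the $\mathbb{F}_Q$-span of $\{\mathrm{ev}_J(X^{\boldsymbol{a}}):\boldsymbol{a}\in\Delta\}$ in $\mathbb{F}_Q^{n_J}$, and the subfield-subcode is $\mathcal{C}^J_\Delta=E^J_\Delta\cap\mathbb{F}_q^{n_J}$, a linear code over $\mathbb{F}_q$. **Cyclotomic sets.** Multiplication by $q$ on $\mathcal{H}_J$ is componentwise: if $j\in J$, $\{0,\dots,T_j\}$ is identified with $\mathbb{Z}/(T_j+1)\mathbb{Z}$; if $j\notin J$, $\{1,\dots,T_j\}$ is identified with $\mathbb{Z}/T_j\mathbb{Z}$ and $q\cdot 0=0$. Minimal cyclotomic sets are the sets $\{q^i\boldsymbol{y}:i\ge0\}$, $\boldsymbol{y}\in\mathcal{H}_J$. The representative of a minimal cyclotomic set is its lexicographically smallest element (minimal first coordinate, then minimal second coordinate among those, etc.). $\mathcal{A}$ is the set of all representatives and $\mathfrak{I}_{\boldsymbol{a}}$ is the minimal cyclotomic set with representative $\boldsymbol{a}\in\mathcal{A}$.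 For $\boldsymbol{a}\in\mathcal{A}$, $\sigma_L(\boldsymbol{a})=\sum_{j\in L}a_j$, computed in $\mathbb{Z}$. **Locality.** Let $\mathcal{C}$ be a linear code of length $n$ over $\mathbb{F}_q$ with generator matrix having columns $\boldsymbol{c}_1,\dots,\boldsymbol{c}_n$. A set $R\subseteq\{1,\dots,n\}$ with $i\notin R$ is a recovery set for coordinate $i$ if $\boldsymbol{c}_i\in\langle\boldsymbol{c}_j:j\in R\rangle$ (independent of the generator matrix; it means that $x_i$ is determined by $(x_j)_{j\in R}$ for every $\boldsymbol{x}\in\mathcal{C}$). The locality of $i$ is the smallest cardinality of a recovery set for $i$. $\mathcal{C}$ is locally recoverable (LRC) if every coordinate has a recovery set; its locality is the largest locality of its coordinates. *)

(* Defs.v *)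
From HB Require Import structures.
From mathcomp Require Import all_boot all_order all_algebra.
From mathcomp Require Import mpoly.

Set Implicit Arguments.
Unset Strict Implicit.
Unset Printing Implicit Defensive.

Import GRing.Theory.
Local Open Scope ring_scope.

Section Locality.

Variables (F : finFieldType) (n : nat).
Implicit Types (C : {vspace 'rV[F]_n}) (R : {set 'I_n}).

Definition generates C k (G : 'M[F]_(k, n)) : bool :=
  basis_of C [seq row i G | i : 'I_k].

Definition generator_mx C : 'M[F]_(\dim C, n) :=
  \matrix_(i < \dim C) (vbasis C)`_i.

Definition recovers k (G : 'M[F]_(k, n)) (i : 'I_n) R : bool :=
  col i G \in <<[seq col j G | j in R]>>%VS.

(* By recovers_generator_mx below, the choice of the generator matrix is
   immaterial. *)
Definition recovery_set C (i : 'I_n) R : bool :=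
  (i \notin R) && recovers (generator_mx C) i R.

(* A recovery set has at most n.-1 elements, so the value n of this minimum
   means that there is none. *)
Definition coord_locality C (i : 'I_n) : nat :=
  \big[minn/n]_(R : {set 'I_n} | recovery_set C i R) #|R|.

Definition is_LRC C : bool :=
  [forall i : 'I_n, [exists R : {set 'I_n}, recovery_set C i R]].

Definition locality C : nat := (\max_(i < n) coord_locality C i)%N.

Lemma generator_mxP C : generates C (generator_mx C).
Proof.
rewrite /generates (_ : [seq _ | _ in _] = vbasis C) ?vbasisP //.
apply: (@eq_from_nth _ 0); first by rewrite size_map size_enum_ord size_tuple.
move=> i; rewrite size_map size_enum_ord => lti.
rewrite (nth_map (Ordinal lti)) ?size_enum_ord //.
by apply/rowP=> j; rewrite !mxE nth_enum_ord.
Qed.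

Lemma mem_span_imageP (V : vectType F) (I : finType) (A : {pred I})
    (f : I -> V) (v : V) :
  reflect (exists w : I -> F, v = \sum_(i in A) w i *: f i)
          (v \in <<[seq f i | i in A]>>%VS).
Proof.
rewrite span_def big_image; apply: (iffP memv_sumP) => [[vs vsP ->] | [w ->]].
  have /fin_all_exists[w wE] i : exists c, i \in A -> vs i = c *: f i.
    by case: (boolP (i \in A)) => [/vsP/vlineP[c ->] | _]; [exists c | exists 0].
  by exists w; apply: eq_bigr.
by exists (fun i => w i *: f i) => // i _; apply/vlineP; exists (w i).
Qed.

(* The coordinate i of every codeword is determined by those in R. *)
Lemma recoversP C k (G : 'M[F]_(k, n)) (i : 'I_n) R : generates C G ->
  reflect (exists w : 'I_n -> F,
             forall x, x \in C -> x 0 i = \sum_(j in R) w j * x 0 j)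
          (recovers G i R).
Proof.
move=> /andP[/eqP spanG _].
apply: (iffP (mem_span_imageP _ _ _)) => [[w wE] | [w wE]]; exists w.
  move=> x; rewrite -spanG => /mem_span_imageP[a ->].
  rewrite summxE; under [RHS]eq_bigr do rewrite summxE mulr_sumr.
  rewrite exchange_big; apply: eq_bigr => h _.
  move/colP/(_ h): wE; rewrite !mxE summxE => ->; rewrite mulr_sumr.
  by apply: eq_bigr => j _; rewrite !mxE mulrCA.
apply/colP=> h; rewrite mxE summxE.
have rowC : row h G \in C by rewrite -spanG; apply/memv_span/image_f.
have := wE _ rowC; rewrite !mxE => ->.
by apply: eq_bigr => j _; rewrite !mxE.
Qed.

Lemma recovers_generator_mx C k (G : 'M[F]_(k, n)) (i : 'I_n) R :
  generates C G -> recovers G i R = recovers (generator_mx C) i R.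
Proof.
move=> genG.
exact: (sameP (recoversP i R genG) (recoversP i R (generator_mxP C))).
Qed.

End Locality.

Section SubfieldSubcode.

Variables (Fq FQ : finFieldType) (iota : {rmorphism Fq -> FQ}) (n : nat).

Definition subfield_subcode (E : {vspace 'rV[FQ]_n}) : {vspace 'rV[Fq]_n} :=
  <<[seq c <- enum 'rV[Fq]_n | map_mx iota c \in E]>>%VS.

(* The span adds nothing: the words it is taken over form a subspace. *)
Lemma mem_subfield_subcode E c :
  (c \in subfield_subcode E) = (map_mx iota c \in E).
Proof.
apply/idP/idP => [cC | cE]; last first.
  by rewrite memv_span // mem_filter cE mem_enum.
pose X := in_tuple [seq c <- enum 'rV[Fq]_n | map_mx iota c \in E].
rewrite (@coord_span _ _ _ X c cC) raddf_sum.
apply: memv_suml => i _; rewrite /= map_mxZ memvZ //.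
have : X`_i \in X by rewrite mem_nth // size_tuple.
by rewrite mem_filter; case/andP.
Qed.

End SubfieldSubcode.

Section Varieties.

Variables (FQ : finFieldType) (m : nat) (N : 'I_m -> nat) (J : {set 'I_m}).

Definition Igen (j : 'I_m) : {mpoly FQ[m]} :=
  if j \in J then 'X_j ^+ (N j).-1 - 1 else 'X_j ^+ N j - 'X_j.

Definition in_I (f : {mpoly FQ[m]}) : Prop :=
  exists g : 'I_m -> {mpoly FQ[m]}, f = \sum_j g j * Igen j.

Definition zeros : {set {ffun 'I_m -> FQ}} :=
  [set P : {ffun 'I_m -> FQ} | [forall j, (Igen j).@[P] == 0]].

Lemma zerosP (P : {ffun 'I_m -> FQ}) :
  P \in zeros <-> forall f, in_I f -> f.@[P] = 0.
Proof.
rewrite inE; split=> [/forallP P0 f [g ->] | P0].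
  rewrite raddf_sum big1 // => j _.
  by rewrite /= mevalM (eqP (P0 j)) mulr0.
apply/forallP=> j; apply/eqP/P0.
exists (fun k => (k == j)%:R); rewrite (bigD1 j) //= eqxx mul1r big1 ?addr0 //.
by move=> k /negPf->; rewrite mul0r.
Qed.

(* Defined on representatives; by ev_quotient it factors through the quotient
   by the ideal. *)
Definition ev (f : {mpoly FQ[m]}) : 'rV[FQ]_#|zeros| :=
  \row_(i < #|zeros|) f.@[(enum_val i : {ffun 'I_m -> FQ})].

Lemma ev_quotient f g : in_I (f - g) -> ev f = ev g.
Proof.
move=> fg; apply/rowP=> i; rewrite !mxE; apply/eqP.
rewrite -subr_eq0 -mevalB; apply/eqP.
by have /zerosP := enum_valP i; apply.
Qed.

Definition Tmax (j : 'I_m) : nat := if j \in J then (N j - 2)%N else (N j - 1)%N.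

Definition expset : finType := {dffun forall j : 'I_m, 'I_(Tmax j).+1}.

Definition Xpow (a : expset) : {mpoly FQ[m]} := 'X_[ [multinom (a j : nat) | j < m] ].

Definition Ecode (D : {set expset}) : {vspace 'rV[FQ]_#|zeros|} :=
  <<[seq ev (Xpow a) | a in D]>>%VS.

End Varieties.

Section Cyclotomic.

Variables (q m : nat) (N : 'I_m -> nat) (J L : {set 'I_m}).
Local Notation H := (expset N J).
Implicit Types (a b y : H).

(* For j \notin J, the nonzero exponents 1, ..., Tmax j represent the
   integers modulo Tmax j, so the class of 0 is represented by Tmax j. *)
Definition mulq_exp (j : 'I_m) (k : nat) : nat :=
  if j \in J then (q * k %% (Tmax N J j).+1)%N
  else if k == 0%N then 0%N else ((q * k).-1 %% Tmax N J j).+1.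

Definition mulq y : H := [ffun j => inord (mulq_exp j (y j))].

(* The truncation in inord never occurs. *)
Lemma mulqE y (j : 'I_m) : mulq y j = mulq_exp j (y j) :> nat.
Proof.
rewrite ffunE inordK // /mulq_exp; case: ifP => _; first by rewrite ltn_mod.
case: eqP => // y0; rewrite ltnS ltn_mod.
apply: leq_trans (ltn_ord (y j) : y j <= Tmax N J j)%N.
by rewrite lt0n; apply/eqP.
Qed.

Definition cyclotomic_set y : {set H} := [set z | fconnect mulq y z].

Definition minimal_cyclotomic_sets : {set {set H}} :=
  [set cyclotomic_set y | y : H].

Definition lexle a b : bool :=
  (a == b) ||
  [exists j, (a j < b j)%N && [forall (k : 'I_m | (k < j)%N), a k == b k]].

Definition is_rep (I : {set H}) a : bool :=
  (a \in I) && [forall z in I, lexle a z].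

Definition representatives : {set H} :=
  [set a | [exists I in minimal_cyclotomic_sets, is_rep I a]].

Lemma mulq_exp_inj (j : 'I_m) (u v : nat) :
    (0 < q)%N -> (1 < N j)%N -> coprime (N j - 1) q ->
    (u <= Tmax N J j)%N -> (v <= Tmax N J j)%N ->
  mulq_exp j u = mulq_exp j v -> u = v.
Proof.
move=> q_gt0 N_gt1 co; rewrite /mulq_exp /Tmax.
have cancel (x y : nat) : q * x = q * y %[mod N j - 1] -> x = y %[mod N j - 1].
  wlog le_xy : x y / (x <= y)%N => [IH E|].
    by case/orP: (leq_total x y) => le; [|symmetry]; apply: IH.
  move/esym/eqP; rewrite eqn_mod_dvd ?leq_mul // -mulnBr Gauss_dvdr //.
  by rewrite -eqn_mod_dvd // => /eqP.
case: ifP => _.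
  rewrite -[(u <= _)%N]ltnS -[(v <= _)%N]ltnS; have -> : ((N j - 2).+1 = N j - 1)%N by rewrite -subSn.
  by move=> ltu ltv /cancel; rewrite !modn_small.
case: (posnP u) (posnP v) => [->|u_gt0] [->|v_gt0] //= le_u le_v.
case=> E; have {}E : q * u = q * v %[mod N j - 1].
  have qu : (0 < q * u)%N by rewrite muln_gt0 q_gt0.
  have qv : (0 < q * v)%N by rewrite muln_gt0 q_gt0.
  apply/eqP; rewrite -[(q * u)%N](prednK qu) -[(q * v)%N](prednK qv).
  by rewrite -[(q * u).-1.+1]addn1 -[(q * v).-1.+1]addn1 eqn_modDr E.
move/cancel: E; move: le_u le_v.
rewrite (leq_eqVlt u) (leq_eqVlt v).
case: eqP => [->|_] /=; case: eqP => [->|_] //= ltu ltv.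
- by rewrite modnn modn_small // => v0; rewrite -v0 in v_gt0.
- by rewrite modnn modn_small // => u0; rewrite u0 in u_gt0.
- by rewrite !modn_small.
Qed.

Lemma mulq_inj : (0 < q)%N -> (forall j, 1 < N j)%N ->
  (forall j, coprime (N j - 1) q) -> injective mulq.
Proof.
move=> q_gt0 N_gt1 coNq a b eq_ab; apply/ffunP=> j; apply/val_inj.
apply: (@mulq_exp_inj j) => //; [exact: (ltn_ord (a j)) | exact: (ltn_ord (b j)) |].
by have := congr1 (fun c : H => c j : nat) eq_ab; rewrite !mulqE.
Qed.

(* Hence the minimal cyclotomic set with representative a is the orbit of a. *)
Lemma rep_cyclotomic_set (I : {set H}) a : injective mulq ->
  I \in minimal_cyclotomic_sets -> is_rep I a -> I = cyclotomic_set a.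
Proof.
move=> inj_q /imsetP[y _ ->] /andP[]; rewrite inE => y_a _.
apply/setP=> z; rewrite !inE.
exact: (same_connect (fconnect_sym inj_q) y_a).
Qed.

Definition sigma a : nat := (\sum_(j in L) a j)%N.

End Cyclotomic.

(* Main.v *)
(** Multiplying the coordinates in [L] of a point [P] by powers of a primitive
    element [xi] of the small field keeps it in the zero set, since [q - 1]
    divides [N j - 1] for [j] in [L].  As [q = 1] modulo [q - 1], the integer
    [sigma L b] modulo [q - 1] is the same for all [b] in the cyclotomic set
    of [a_i]; so on these points [P_0 = P, P_1, P_2, ...] the monomial [X^b]
    takes the values [b(P) * (xi ^ sigma L a_i) ^ k].  The coefficients of the
    polynomial with roots [xi ^ sigma L a_i], which has degree [r] and a nonzero
    constant term, thus give a linear relation between the coordinates of a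
    codeword at [P_0, ..., P_r], in which [P_0] has a nonzero coefficient. *)
Require Import Defs.
From mathcomp Require Import all_boot all_order all_algebra.
From mathcomp Require Import cyclic finfield mpoly.

Set Implicit Arguments.
Unset Strict Implicit.
Unset Printing Implicit Defensive.

Import GRing.Theory.

Section LocalRelations.

Variables (F : finFieldType) (n r : nat).
Implicit Types (C : {vspace 'rV[F]_n}) (f : 'I_r -> 'I_n) (w : 'I_r -> F).
Local Open Scope ring_scope.

Lemma recovery_set_image C i f w :
    (forall k, f k != i) ->
    (forall x, x \in C -> x 0 i = \sum_k w k * x 0 (f k)) ->
  recovery_set C i [set f k | k : 'I_r].
Proof.
move=> f_neq wE; apply/andP; split.
  by apply/imsetP=> -[k _ def_i]; have := f_neq k; rewrite -def_i eqxx.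
apply/(recoversP _ _ (generator_mxP C)).
(* [f] may repeat a coordinate, so the weight of [j] is the total over its fibre. *)
exists (fun j => \sum_(k | f k == j) w k) => x /wE ->.
rewrite (partition_big_imset f); apply: eq_bigr => j _ /=.
by rewrite mulr_suml; apply: eq_bigr => k /eqP->.
Qed.

Lemma LRC_of_relations C :
    (forall i, exists f w, (forall k, f k != i) /\
       forall x, x \in C -> x 0 i = \sum_k w k * x 0 (f k)) ->
  is_LRC C /\ (locality C <= r)%N.
Proof.
move=> relC.
have recC i : exists2 R, recovery_set C i R & (#|R| <= r)%N.
  have [f [w [f_neq wE]]] := relC i.
  exists [set f k | k : 'I_r]; first exact: recovery_set_image wE.
  by rewrite (leq_trans (leq_imset_card _ _)) // card_ord.
split.
  by apply/forallP=> i; have [R recR _] := recC i; apply/existsP; exists R.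
apply/bigmax_leqP=> i _; have [R recR leR] := recC i.
apply: leq_trans leR; rewrite /coord_locality -minEnat -leEnat.
exact: Order.TotalTheory.bigmin_le_cond.
Qed.

End LocalRelations.

(** The [#|F|.-1] nonzero elements are distinct roots of unity of order dividing their number, which
    forces one of them to be primitive. *)
Lemma finField_prim_root (F : finFieldType) :
  exists xi : F, #|F|.-1.-primitive_root%R xi.
Proof.
have card_gt0 : 0 < #|F| by apply: ltnW (card_finNzRing_gt1 F).
pose rs := enum (predC1 (0%R : F)).
have sz_rs : size rs = #|F|.-1 by rewrite -cardE cardC1.
suff /hasP[xi _ xiP]: has #|F|.-1.-primitive_root%R rs by exists xi.
apply: has_prim_root; rewrite ?sz_rs ?enum_uniq //.
  by rewrite -ltnS prednK ?card_finNzRing_gt1.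
apply/allP=> x; rewrite mem_enum => x_neq0.
apply/unity_rootP/(mulfI x_neq0).
by rewrite -exprS prednK // expf_card mulr1.
Qed.

Section Evaluation.

Variables (FQ : finFieldType) (m : nat) (N : 'I_m -> nat) (J L : {set 'I_m}).
Implicit Types (P : {ffun 'I_m -> FQ}) (c : FQ) (b : expset N J).
Local Open Scope ring_scope.

Definition scale_coords c P : {ffun 'I_m -> FQ} :=
  [ffun j => (if j \in L then c else 1) * P j].

Lemma mem_zeros P : (P \in zeros FQ N J) =
  [forall j, if j \in J then P j ^+ (N j).-1 == 1 else P j ^+ N j == P j].
Proof.
rewrite inE; apply: eq_forallb => j; rewrite /Igen; case: ifP => _.
  by rewrite mevalB rmorphXn /= mevalXU meval1 subr_eq0.
by rewrite mevalB rmorphXn /= mevalXU subr_eq0.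
Qed.

(** On [L], contained in [J], the defining equations are [P j ^+ (N j).-1 = 1], which are stable
    under products; the other coordinates do not change. *)
Lemma scale_coords_zeros c P : L \subset J ->
    (forall j, j \in L -> c ^+ (N j).-1 = 1) ->
  P \in zeros FQ N J -> scale_coords c P \in zeros FQ N J.
Proof.
move=> sub_LJ c1; rewrite !mem_zeros => /forallP P0; apply/forallP=> j.
have := P0 j; rewrite ffunE.
case: (boolP (j \in L)) => [jL | _]; last by rewrite mul1r.
by rewrite (subsetP sub_LJ _ jL) exprMn c1 // mul1r.
Qed.

Lemma zeros_neq0 P j : (1 < N j)%N -> j \in J -> P \in zeros FQ N J ->
  P j != 0.
Proof.
move=> N_gt1 jJ; rewrite mem_zeros => /forallP/(_ j); rewrite jJ.
apply: contraTneq => ->; rewrite expr0n.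
by case: (N j) N_gt1 => [|[|k]] //= _; rewrite eq_sym oner_eq0.
Qed.

Lemma meval_Xpow P b : (Xpow FQ b).@[P] = \prod_j P j ^+ b j.
Proof. by rewrite mevalX; apply: eq_bigr => j _; rewrite mnmE. Qed.

Lemma meval_Xpow_scale c P b :
  (Xpow FQ b).@[scale_coords c P] = c ^+ sigma L b * (Xpow FQ b).@[P].
Proof.
rewrite !meval_Xpow /sigma -prodrXr [in RHS]big_mkcond -big_split /=.
by apply: eq_bigr => j _; rewrite ffunE exprMn; case: ifP; rewrite ?expr1n.
Qed.

End Evaluation.

(** For [j] in [L], [mulq] multiplies the exponent by [q] modulo [N j - 1], a multiple of [q - 1];
    hence it fixes each such exponent modulo [q - 1]. *)
Lemma sigma_cyclotomic_set (q m : nat) (N : 'I_m -> nat) (J L : {set 'I_m})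
    (y z : expset N J) :
    0 < q -> (forall j, 1 < N j) -> L \subset J ->
    (forall j, j \in L -> q - 1 %| N j - 1) ->
  z \in cyclotomic_set q y -> sigma L z = sigma L y %[mod q - 1].
Proof.
move=> q_gt0 N_gt1 sub_LJ q_dvd; rewrite inE => /iter_findex <-.
elim: (findex _ _ _) => //= k <-; set x := iter _ _ _.
rewrite /sigma -modn_summ -[in RHS]modn_summ; congr (_ %% _).
apply: eq_bigr => j jL; rewrite mulqE; move: (x j : nat) => u.
rewrite /mulq_exp /Tmax (subsetP sub_LJ _ jL).
have -> : (N j - 2).+1 = N j - 1 by rewrite -subSn.
rewrite modn_dvdm ?q_dvd // -{1}(subnK q_gt0) mulnDl mul1n.
by rewrite -modnDml modnMr add0n.
Qed.

Theorem theorem2p8 (p s l m : nat)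
    (p_prime : prime p) (s_gt0 : 0 < s) (l_gt0 : 0 < l) (s_dvd_l : s %| l)
    (Fq FQ : finFieldType) (iota : {rmorphism Fq -> FQ})
    (card_Fq : #|Fq| = p ^ s) (card_FQ : #|FQ| = p ^ l)
    (m_gt0 : 0 < m) (N : 'I_m -> nat)
    (N_gt1 : forall j, 1 < N j) (N_dvd : forall j, N j - 1 %| p ^ l - 1)
    (J L : {set 'I_m}) (L_neq0 : L != set0) (sub_LJ : L \subset J)
    (q_dvd : forall j, j \in L -> p ^ s - 1 %| N j - 1)
    (r : nat) (r_gt0 : 0 < r) (r_le : r <= p ^ s - 2)
    (a : 'I_r -> expset N J) (a_inj : injective a)
    (a_rep : forall i, a i \in representatives (p ^ s) N J)
    (a_sigma : forall i k, i != k ->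
       sigma L (a i) <> sigma L (a k) %[mod p ^ s - 1]) :
  let Delta := \bigcup_(i < r) cyclotomic_set (p ^ s) (a i) in
  let C := subfield_subcode iota (Ecode FQ Delta) in
  is_LRC C /\ locality C <= r.
Proof.
move=> Delta C; apply: LRC_of_relations => i.
have [xi xiP] := finField_prim_root Fq.
have q_gt0 : 0 < p ^ s by rewrite expn_gt0 prime_gt0.
rewrite card_Fq -subn1 in xiP.
have r_lt : r < p ^ s - 1.
  apply: leq_ltn_trans r_le _.
  by rewrite ltn_sub2l // -card_Fq card_finNzRing_gt1.
have xi_neq0 : xi != 0%R.
  by rewrite (prim_root_eq0 xiP) -lt0n (leq_ltn_trans _ r_lt).
pose P : {ffun 'I_m -> FQ} := enum_val i.
have PZ : P \in zeros FQ N J by apply: enum_valP.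
pose Q k := scale_coords L (iota xi ^+ k)%R P.
have QZ k : Q k \in zeros FQ N J.
  apply: scale_coords_zeros => // j jL; rewrite -rmorphXn -rmorphXn -exprM.
  apply/eqP; rewrite fmorph_eq1 -(prim_order_dvd xiP) dvdn_mull //.
  by rewrite -subn1 q_dvd.
(* The position of [Q k] in a codeword; [PZ] only shows that the zero set is inhabited. *)
pose idx k := enum_rank_in PZ (Q k).
have idxK k : enum_val (idx k) = Q k by apply: enum_rankK_in.
have idx0 : idx 0 = i.
  apply: enum_val_inj; rewrite idxK; apply/ffunP=> j.
  by rewrite ffunE expr0 if_same mul1r.
pose M : {poly Fq} := (\prod_(t < r) ('X - (xi ^+ sigma L (a t))%:P))%R.
have szM : size M = r.+1.
  by rewrite size_prod_XsubC /index_enum -enumT size_enum_ord.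
have M0 : (M`_0 != 0)%R.
  rewrite -horner_coef0 horner_prod; apply/prodf_neq0 => t _.
  by rewrite hornerXsubC sub0r oppr_eq0 expf_neq0.
exists (fun k : 'I_r => idx k.+1),
  (fun k : 'I_r => - (M`_k.+1 / M`_0))%R; split.
  (* If [Q k.+1] were [P], a coordinate in [L], where [P] is nonzero, would give [xi ^+ k.+1 = 1],
     although [k.+1 <= r] is less than the order of [xi]. *)
  move=> k; rewrite -idx0; apply/eqP=> /(congr1 enum_val); rewrite !idxK.
  have [j jL] := set0Pn _ L_neq0.
  have jJ := subsetP sub_LJ _ jL; have Pj := zeros_neq0 (N_gt1 j) jJ PZ.
  move/ffunP/(_ j); rewrite !ffunE jL expr0 => /(mulIf Pj)/eqP.
  rewrite -rmorphXn fmorph_eq1 -(prim_order_dvd xiP) => /dvdn_leq.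
  by move/(_ isT); rewrite leqNgt (leq_ltn_trans (ltn_ord k) r_lt).
move=> x; rewrite mem_subfield_subcode => /mem_span_imageP[w xE].
suff relM : (\sum_(k < r.+1) M`_k * x ord0 (idx k) = 0)%R.
  move: relM; rewrite big_ord_recl /= idx0 => /(canRL (addrK _)).
  rewrite sub0r => /(canRL (mulKf M0)) ->; rewrite mulrN mulr_sumr -sumrN.
  by apply: eq_bigr => k _; rewrite mulNr mulrA [(_^-1 * _)%R]mulrC.
(* The relation is checked in [FQ], where [x] is a combination of evaluated monomials. *)
apply: (fmorph_inj iota); rewrite rmorph0 rmorph_sum /=.
have xval k : iota (x ord0 (idx k)) =
    (\sum_(b in Delta)
       iota (xi ^+ sigma L b) ^+ k * (w b * (Xpow FQ b).@[P]))%R.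
  move/rowP/(_ (idx k)): xE; rewrite mxE summxE => ->.
  apply: eq_bigr => b _; rewrite !mxE idxK meval_Xpow_scale mulrCA.
  by rewrite rmorphXn -!exprM mulnC.
under eq_bigr => k _ do rewrite rmorphM xval mulr_sumr.
(* After the exchange, the monomial [b] contributes a multiple of [M] evaluated at
   [xi ^+ sigma L b]. *)
rewrite exchange_big big1 //= => b /bigcupP[t _ bt].
under eq_bigr => k _ do rewrite (mulrA (iota M`_k)%R) -rmorphXn -rmorphM.
rewrite -mulr_suml -rmorph_sum -szM -horner_coef.
suff -> : M.[xi ^+ sigma L b]%R = 0%R by rewrite rmorph0 mul0r.
(* Since [b] lies in the orbit of [a t], this power of [xi] is the root of the factor [t] of [M]. *)
rewrite -(prim_expr_mod xiP) (sigma_cyclotomic_set q_gt0 _ _ _ bt) //.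
rewrite (prim_expr_mod xiP) horner_prod (bigD1 t) //= hornerXsubC subrr.
by rewrite mul0r.
Qed.
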